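(* Let $M$ be a finite set of indivisible goods and let $v_1,v_2:2^M\to\mathbb{R}_{\ge0}$ be normalized, monotone, submodular valuations of two agents (not necessarily leveled). Then there exists a complete allocation $(A_1,A_2)\in\Pi_2(M)$ that is $2/3$-MMS, i.e. $v_i(A_i)\ge \tfrac23\,\mu_i^2(M)$ for $i=1,2$.
   Context: A valuation $v:2^M\to\mathbb{R}_{\ge0}$ is normalized if $v(\emptyset)=0$, monotone if $v(S)\le v(T)$ whenever $S\subseteq T$, submodular if $v(S)+v(T)\ge v(S\cup T)+v(S\cap T)$ for all $S,T\subseteq M$, and leveled if $v(S)>v(T)$ whenever $|S|>|T|$. $\Pi_2(M)$ is the set of ordered pairs of disjoint (possibly empty) subsets of $M$ with union $M$. The maximin share of agent $i$ is $\mu_i^2(M)=\max_{(B_1,B_2)\in\Pi_2(M)}\min\{v_i(B_1),v_i(B_2)\}$. *)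

(* Defs.v *)
From HB Require Import structures.
From mathcomp Require Import all_boot all_order all_algebra.
From mathcomp Require Import reals.

Set Implicit Arguments.
Unset Strict Implicit.
Unset Printing Implicit Defensive.

Import Order.TTheory GRing.Theory Num.Theory.
Local Open Scope ring_scope.

(* The goods are the elements of a finType [M], so a bundle is a [{set M}]. *)

Definition nonnegative (R : realType) (M : finType) (v : {set M} -> R) : Prop :=
  forall S : {set M}, 0 <= v S.

Definition normalized (R : realType) (M : finType) (v : {set M} -> R) : Prop :=
  v set0 = 0.

Definition monotone_val (R : realType) (M : finType) (v : {set M} -> R) : Prop :=
  forall S T : {set M}, S \subset T -> v S <= v T.

Definition submodular (R : realType) (M : finType) (v : {set M} -> R) : Prop :=
  forall S T : {set M}, v S + v T >= v (S :|: T) + v (S :&: T).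

Definition Pi2 (M : finType) : {set {set M} * {set M}} :=
  [set B : {set M} * {set M} | [disjoint B.1 & B.2] & B.1 :|: B.2 == [set: M]].

(* The maximum of min(v(B1), v(B2)) over Pi2. Since (set0, setT) always belongs
   to Pi2, starting the iterated max from its value adds no spurious
   candidate. *)
Definition mms2 (R : realType) (M : finType) (v : {set M} -> R) : R :=
  \big[Num.max/Num.min (v set0) (v [set: M])]_(B in Pi2 M)
     Num.min (v B.1) (v B.2).

Lemma mms2_ge (R : realType) (M : finType) (v : {set M} -> R)
    (B : {set M} * {set M}) :
  B \in Pi2 M -> Num.min (v B.1) (v B.2) <= mms2 v.
Proof. by move=> BP; rewrite /mms2 (bigD1 B) //= le_max lexx. Qed.

Lemma mms2_attained (R : realType) (M : finType) (v : {set M} -> R) :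
  exists2 B, B \in Pi2 M & mms2 v = Num.min (v B.1) (v B.2).
Proof.
rewrite /mms2; apply: (big_ind (fun x => exists2 B, B \in Pi2 M &
  x = Num.min (v B.1) (v B.2))).
- exists (set0, [set: M]) => //.
  by rewrite inE /= set0U eqxx andbT -setI_eq0 set0I.
- move=> x y [B BP ->] [C CP ->].
  by case: leP => _; [exists C | exists B].
- by move=> B BP; exists B.
Qed.

(* Main.v *)
Require Import Defs.
From HB Require Import structures.
From mathcomp Require Import all_boot all_order all_algebra.
From mathcomp Require Import reals.
From mathcomp Require Import lra.

Import Order.TTheory GRing.Theory Num.Theory.
Local Open Scope ring_scope.

(** Let (P_i, ~P_i) be an optimal partition for agent i.  If some part of one
    agent's partition is worth at least 2/3 of the maximin share to the other
    agent, hand it over and keep the other part.  Otherwise both agents value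
    both parts of the other's partition below 2/3, and then each of them values
    both "diagonals", the symmetric difference of P_1 and P_2 and its
    complement, at 2/3 or more, so they can take one diagonal each. *)

Lemma setC_Pi2 (M : finType) (A : {set M}) : (A, ~: A) \in Pi2 M.
Proof. by rewrite inE /= -setI_eq0 setICr setUCr !eqxx. Qed.

Lemma Pi2_setC (M : finType) (B : {set M} * {set M}) :
  B \in Pi2 M -> B.2 = ~: B.1.
Proof.
rewrite inE -setI_eq0 => /andP[/eqP dB /eqP UB]; apply/setP=> x.
have := in_set0 x; have := in_setT x.
by rewrite -dB -UB !inE; case: (x \in B.1); case: (x \in B.2).
Qed.

Lemma mms2_partition (R : realType) (M : finType) (v : {set M} -> R) :
  exists P : {set M}, mms2 v <= v P /\ mms2 v <= v (~: P).
Proof.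
have [B BP ->] := mms2_attained v; exists B.1.
by rewrite -(Pi2_setC _ _ BP) !ge_min !lexx orbT.
Qed.

Lemma mms2_ge0 (R : realType) (M : finType) (v : {set M} -> R) :
  nonnegative v -> 0 <= mms2 v.
Proof. by move=> v0; have [B _ ->] := mms2_attained v; rewrite le_min !v0. Qed.

(** Subadditivity on [P] leaves [P :&: X] at least m - 2m/3 = m/3. Submodularity on [X] and the
    diagonal then gives the diagonal at least m + m/3 - 2m/3 = 2m/3. *)
Lemma diagonal_ge (R : realType) (M : finType) (v : {set M} -> R) (m : R)
    (P X : {set M}) :
  normalized v -> monotone_val v -> submodular v ->
  m <= v P -> m <= v (~: P) ->
  v X <= 2%:R / 3%:R * m -> v (~: X) <= 2%:R / 3%:R * m ->
  2%:R / 3%:R * m <= v ((P :&: X) :|: (~: P :&: ~: X)).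
Proof.
move=> v0 vmono vsub mP mPC vX vXC; set S := _ :|: _.
have PX : v P <= v (P :&: X) + v (P :&: ~: X).
  have := vsub (P :&: X) (P :&: ~: X).
  by rewrite -setIUr setUCr setIT setIACA setICr setI0 v0 addr0.
have PXC : v (P :&: ~: X) <= v (~: X) by apply: vmono; apply: subsetIr.
(* [X :|: S] contains [~: P], and [X :&: S] contains [P :&: X]. *)
have XS : v (~: P) + v (P :&: X) <= v X + v S.
  apply: le_trans (vsub X S); apply: lerD; apply: vmono; apply/subsetP=> x;
    by rewrite !inE; case: (x \in P); case: (x \in X).
lra.
Qed.

Theorem theorem2 (R : realType) (M : finType) (v1 v2 : {set M} -> R)
  (v1_nneg : nonnegative v1) (v2_nneg : nonnegative v2)
  (v1_norm : normalized v1) (v2_norm : normalized v2)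
  (v1_mono : monotone_val v1) (v2_mono : monotone_val v2)
  (v1_submod : submodular v1) (v2_submod : submodular v2) :
  exists A : {set M} * {set M},
    [/\ A \in Pi2 M,
        v1 A.1 >= 2%:R / 3%:R * mms2 v1 &
        v2 A.2 >= 2%:R / 3%:R * mms2 v2].
Proof.
have [P1 [v1P v1PC]] := mms2_partition _ _ v1.
have [P2 [v2P v2PC]] := mms2_partition _ _ v2.
(* Nonnegativity makes a part worth the full share also worth 2/3 of it. *)
have m1_ge0 := mms2_ge0 _ _ _ v1_nneg; have m2_ge0 := mms2_ge0 _ _ _ v2_nneg.
have [v1P2|v1P2] := leP (2%:R / 3%:R * mms2 v1) (v1 P2).
  by exists (P2, ~: P2); split=> //=; [apply: setC_Pi2 | lra].
have [v1P2C|v1P2C] := leP (2%:R / 3%:R * mms2 v1) (v1 (~: P2)).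
  exists (~: P2, ~: ~: P2); split=> //=; first exact: setC_Pi2.
  by rewrite setCK; lra.
have [v2P1|v2P1] := leP (2%:R / 3%:R * mms2 v2) (v2 P1).
  exists (~: P1, ~: ~: P1); split=> //=; [exact: setC_Pi2 | lra |].
  by rewrite setCK.
have [v2P1C|v2P1C] := leP (2%:R / 3%:R * mms2 v2) (v2 (~: P1)).
  by exists (P1, ~: P1); split=> //=; [apply: setC_Pi2 | lra].
set S := (P1 :&: P2) :|: (~: P1 :&: ~: P2).
(* The other diagonal has the shape of [diagonal_ge] for agent 2, with [P2] as [P] and [~: P1] as
   [X]. *)
have SC : ~: S = (P2 :&: ~: P1) :|: (~: P2 :&: ~: ~: P1).
  by apply/setP=> x; rewrite !inE; case: (x \in P1); case: (x \in P2).
exists (S, ~: S); split=> /=; first exact: setC_Pi2.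
  by apply: diagonal_ge => //; apply: ltW.
by rewrite SC; apply: diagonal_ge; rewrite ?setCK //; apply: ltW.
Qed.
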